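(* The logics $\mathsf{iSL}^+_{\mathsf a}$ and $\mathsf{iSL}_{\Box}$ have uniform interpolation. That is, for $\Lambda$ either of these logics, for every formula $\phi$ in the language of $\Lambda$ and every finite set $\widetilde q$ of propositional variables, there are formulas $\exists\widetilde q\,\phi$ and $\forall\widetilde q\,\phi$ in the language of $\Lambda$, all of whose propositional variables lie in $\mathsf{PV}(\phi)\setminus\widetilde q$, such that for every formula $\psi$ in the language of $\Lambda$ with $\mathsf{PV}(\psi)\cap\widetilde q=\emptyset$: $$\Lambda\vdash\phi\to\psi \iff \Lambda\vdash\exists\widetilde q\,\phi\to\psi\qquad\text{and}\qquad \Lambda\vdash\psi\to\phi\iff\Lambda\vdash\psi\to\forall\widetilde q\,\phi .$$
   Context: $\mathsf{PV}(\phi)$ is the set of propositional variables occurring in $\phi$. Formulas of $\mathbb L(\rightsquigarrow)$ are built from propositional variables, $\top,\bot$, and binary connectives $\wedge,\vee,\to,\rightsquigarrow$; in this language $\Box\phi:=(\top\rightsquigarrow\phi)$. Formulas of $\mathbb L(\Box)$ are built from propositional variables, $\top,\bot$, $\wedge,\vee,\to$ and a primitive unary operator $\Box$. The system $\mathsf{HLC}^\sharp$ (in $\mathbb L(\rightsquigarrow)$) is axiomatised by all axioms and rules of intuitionistic propositional logic, the rule: from $\vdash\phi\to\psi$ infer $\vdash\phi\rightsquigarrow\psi$, and the axiom schemes $((\phi\rightsquigarrow\psi)\wedge(\psi\rightsquigarrow\chi))\to(\phi\rightsquigarrow\chi)$, $((\phi\rightsquigarrow\psi)\wedge(\phi\rightsquigarrow\chi))\to(\phi\rightsquigarrow(\psi\wedge\chi))$,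 $((\phi\rightsquigarrow\chi)\wedge(\psi\rightsquigarrow\chi))\to((\phi\vee\psi)\rightsquigarrow\chi)$. $\mathsf{iSL}^+_{\mathsf a}$ is $\mathsf{HLC}^\sharp$ plus the axiom schemes $(\Box\phi\to\phi)\to\phi$ and $((\chi\wedge\phi)\rightsquigarrow\psi)\to(\chi\rightsquigarrow(\phi\to\psi))$. $\mathsf{iSL}_\Box$ (in $\mathbb L(\Box)$) is $\mathsf{iK}_\Box$ plus the axiom scheme $(\Box\phi\to\phi)\to\phi$, where $\mathsf{iK}_\Box$ is intuitionistic propositional logic with the axiom scheme $\Box(\phi\to\psi)\to(\Box\phi\to\Box\psi)$ and the necessitation rule (from $\vdash\phi$ infer $\vdash\Box\phi$). *)

(* Defs.v *)
From mathcomp Require Import all_boot finmap.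

Set Implicit Arguments.
Unset Strict Implicit.
Unset Printing Implicit Defensive.

Local Open Scope fset_scope.

Definition var := nat.

Inductive formA : Type :=
| VarA of var
| TopA
| BotA
| AndA of formA & formA
| OrA of formA & formA
| ImpA of formA & formA
| StrictA of formA & formA.

Inductive formB : Type :=
| VarB of var
| TopB
| BotB
| AndB of formB & formB
| OrB of formB & formB
| ImpB of formB & formB
| BoxB of formB.

Declare Scope formA_scope.
Delimit Scope formA_scope with A.
Bind Scope formA_scope with formA.
Notation "A /\ B" := (AndA A B) : formA_scope.
Notation "A \/ B" := (OrA A B) : formA_scope.
Notation "A --> B" := (ImpA A B) (at level 90, right associativity) : formA_scope.
Notation "A ~~> B" := (StrictA A B) (at level 88, no associativity) : formA_scope.

Definition BoxA (p : formA) : formA := (TopA ~~> p)%A.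

Declare Scope formB_scope.
Delimit Scope formB_scope with B.
Bind Scope formB_scope with formB.
Notation "A --> B" := (ImpB A B) : formB_scope.

Fixpoint PVA (p : formA) : {fset var} :=
  match p with
  | VarA x => [fset x]
  | TopA | BotA => fset0
  | AndA a b | OrA a b | ImpA a b | StrictA a b => PVA a `|` PVA b
  end.

Fixpoint PVB (p : formB) : {fset var} :=
  match p with
  | VarB x => [fset x]
  | TopB | BotB => fset0
  | AndB a b | OrB a b | ImpB a b => PVB a `|` PVB b
  | BoxB a => PVB a
  end.

(* Hilbert axiom schemes, over an arbitrary type of formulas with the
   intuitionistic connectives; the only rule is modus ponens, which is a
   constructor of each of the calculi below. *)
Inductive ipc_axiom (F : Type) (top bot : F) (and or imp : F -> F -> F) :
  F -> Prop :=
| ipc_K a b : ipc_axiom top bot and or imp (imp a (imp b a))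
| ipc_S a b c : ipc_axiom top bot and or imp
    (imp (imp a (imp b c)) (imp (imp a b) (imp a c)))
| ipc_andI a b : ipc_axiom top bot and or imp (imp a (imp b (and a b)))
| ipc_andEl a b : ipc_axiom top bot and or imp (imp (and a b) a)
| ipc_andEr a b : ipc_axiom top bot and or imp (imp (and a b) b)
| ipc_orIl a b : ipc_axiom top bot and or imp (imp a (or a b))
| ipc_orIr a b : ipc_axiom top bot and or imp (imp b (or a b))
| ipc_orE a b c : ipc_axiom top bot and or imp
    (imp (imp a c) (imp (imp b c) (imp (or a b) c)))
| ipc_botE a : ipc_axiom top bot and or imp (imp bot a)
| ipc_topI : ipc_axiom top bot and or imp top.

Definition ipcA : formA -> Prop := ipc_axiom TopA BotA AndA OrA ImpA.
Definition ipcB : formB -> Prop := ipc_axiom TopB BotB AndB OrB ImpB.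

(* [HLCsharp Ax] is HLC# extended with the axioms in [Ax]; the rules apply to
   all theorems of the extended system. *)
Inductive HLCsharp (Ax : formA -> Prop) : formA -> Prop :=
| HLC_ax p : Ax p -> HLCsharp Ax p
| HLC_ipc p : ipcA p -> HLCsharp Ax p
| HLC_mp p q : HLCsharp Ax (p --> q) -> HLCsharp Ax p -> HLCsharp Ax q
| HLC_nec p q : HLCsharp Ax (p --> q) -> HLCsharp Ax (p ~~> q)
| HLC_tr p q r : HLCsharp Ax (((p ~~> q) /\ (q ~~> r)) --> (p ~~> r))
| HLC_and p q r :
    HLCsharp Ax (((p ~~> q) /\ (p ~~> r)) --> (p ~~> (q /\ r)))
| HLC_or p q r :
    HLCsharp Ax (((p ~~> r) /\ (q ~~> r)) --> ((p \/ q) ~~> r)).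

Inductive iSLa_axiom : formA -> Prop :=
| iSLa_SL p : iSLa_axiom ((BoxA p --> p) --> p)
| iSLa_imp p q r :
    iSLa_axiom (((r /\ p) ~~> q) --> (r ~~> (p --> q))).

Definition iSLa : formA -> Prop := HLCsharp iSLa_axiom.

(* [iKbox Ax] is iK_Box extended with the axioms in [Ax]. *)
Inductive iKbox (Ax : formB -> Prop) : formB -> Prop :=
| iK_ax p : Ax p -> iKbox Ax p
| iK_ipc p : ipcB p -> iKbox Ax p
| iK_mp p q : iKbox Ax (p --> q) -> iKbox Ax p -> iKbox Ax q
| iK_nec p : iKbox Ax p -> iKbox Ax (BoxB p)
| iK_K p q : iKbox Ax (BoxB (p --> q) --> (BoxB p --> BoxB q)).

Inductive iSLbox_axiom : formB -> Prop :=
| iSLbox_SL p : iSLbox_axiom ((BoxB p --> p) --> p).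

Definition iSLbox : formB -> Prop := iKbox iSLbox_axiom.

Definition uniform_interpolation (F : Type) (imp : F -> F -> F)
    (PV : F -> {fset var}) (prov : F -> Prop) : Prop :=
  forall (p : F) (q : {fset var}),
    exists ex all : F,
      [/\ PV ex `<=` PV p `\` q,
          PV all `<=` PV p `\` q
        & forall r : F, PV r `&` q = fset0 ->
            (prov (imp p r) <-> prov (imp ex r)) /\
            (prov (imp r p) <-> prov (imp r all))].

(* Main.v *)
From HB Require Import structures.
From mathcomp Require Import all_boot finmap boolp.
Require Import Defs.
From Stdlib Require Import Wellfounded Wf_nat.

(** Both logics are handled at once because, in presence of the scheme
    [((r /\ p) ~~> q) --> (r ~~> (p --> q))], the arrow [a ~~> b] is provably
    equivalent to the boxed implication [Box (a --> b)] ([derA_strict_imp]).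
    Hence reading the arrow as a boxed implication embeds the first logic in
    the second without changing the variables of a formula ([iSLa_toB]), and
    up to provable equivalence every formula of the box language is reached
    ([toB_toA]); interpolants travel along this embedding.

    For the box logic the argument is semantic.  It is complete for Kripke
    models in which the modal relation is conversely well founded and
    contained in the intuitionistic order ([iSLboxP]).  Over a finite set [Q]
    of variables, the formulas of [layer Q n] decide, up to [n] rounds of the
    bisimulation game played along both relations, which worlds of two models
    look alike; there are finitely many of them, and each class of worlds is
    cut out by a pair of formulas [(a, b)], as the worlds that force [a] and do
    not force [b] ([cells]).

    Fix [p] and [q], let [Q] be the variables of [p] outside [q], and let [n]
    be one more than twice the number of occurrences of subformulas in [p].
    The heart of the proof is amalgamation ([amalgamation]): if [k] and [m] agree on
    [layer Q n], some world [w] of a third model forces the same subformulas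
    of [p] as [k] and the same formulas without variables of [q] as [m].  So
    the answer to the question whether [m] can be changed, on the variables of
    [q] only and up to bisimulation, so as to force (or to refute) [p] depends
    only on the cell of [m].  The existential interpolant says that no world
    above lies in a cell incompatible with [p], the universal one that no
    world above lies in a cell that contains a world refuting [p]; both are
    finite conjunctions of implications [a --> b] with [(a, b)] a cell. *)

Set Implicit Arguments.
Unset Strict Implicit.
Unset Printing Implicit Defensive.

Local Open Scope fset_scope.

HB.instance Definition _ := gen_eqMixin formB.

(** * Derivations from hypotheses in a Hilbert system *)

(** The intuitionistic derivations needed on both sides are the same; the
    structure lets them be written once. *)
Structure logic := Logic {
  fm :> Type;
  top : fm;
  bot : fm;
  and : fm -> fm -> fm;
  or : fm -> fm -> fm;
  imp : fm -> fm -> fm;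
  thm : fm -> Prop;
  thm_ipc : forall p, ipc_axiom top bot and or imp p -> thm p;
  thm_mp : forall p q, thm (imp p q) -> thm p -> thm q
}.

Section Derivations.
Context (L : logic).
Implicit Types (G H : L -> Prop) (a b c f g : L).

(** Only theorems of the logic may enter besides the hypotheses: necessitation
    applies to theorems and not to consequences of [G], which is what makes the
    deduction theorem hold. *)
Inductive der (G : L -> Prop) : L -> Prop :=
| der_thm f : thm f -> der G f
| der_hyp f : G f -> der G f
| der_mp a b : der G (imp a b) -> der G a -> der G b.

Definition add G a : L -> Prop := fun f => G f \/ f = a.

Lemma der_add G a : der (add G a) a.
Proof. by apply: der_hyp; right. Qed.

Lemma der_cut G H f : (forall g, G g -> der H g) -> der G f -> der H f.
Proof.
move=> GH; elim=> {f} [f /der_thm //|f /GH //|a b _ IHab _ IHa].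
exact: der_mp IHab IHa.
Qed.

Lemma der_weak G H f : (forall g, G g -> H g) -> der G f -> der H f.
Proof. by move=> GH; apply: der_cut => g /GH; apply: der_hyp. Qed.

Lemma der_addW G a f : der G f -> der (add G a) f.
Proof. by apply: der_weak => g; left. Qed.

Lemma thm_der f : der (fun=> False) f -> thm f.
Proof. by elim=> {f} // a b _ ? _; apply: thm_mp. Qed.

Lemma der_ipc G f :
  ipc_axiom (top L) (bot L) (@and L) (@or L) (@imp L) f -> der G f.
Proof. by move=> /thm_ipc; apply: der_thm. Qed.

Lemma der_K G a b : der G b -> der G (imp a b).
Proof. by apply: der_mp; apply: der_ipc; apply: ipc_K. Qed.

Lemma deduction G a b : der (add G a) b -> der G (imp a b).
Proof.
elim=> {b} [f thf|f [Gf|->]|b c _ IHbc _ IHb].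
- exact/der_K/der_thm.
- exact/der_K/der_hyp.
- apply: der_mp (der_ipc G (ipc_K _ _ _ _ _ a a)).
  apply: der_mp (der_ipc G (ipc_K _ _ _ _ _ a (imp a a))).
  exact/der_ipc/ipc_S.
- apply: der_mp IHb; apply: der_mp IHbc; exact/der_ipc/ipc_S.
Qed.

Lemma der_andI G a b : der G a -> der G b -> der G (and a b).
Proof.
by move=> da; apply: der_mp; apply: der_mp da; apply/der_ipc/ipc_andI.
Qed.

Lemma der_andEl G a b : der G (and a b) -> der G a.
Proof. by apply: der_mp; apply/der_ipc/ipc_andEl. Qed.

Lemma der_andEr G a b : der G (and a b) -> der G b.
Proof. by apply: der_mp; apply/der_ipc/ipc_andEr. Qed.

Lemma der_orIl G a b : der G a -> der G (or a b).
Proof. by apply: der_mp; apply/der_ipc/ipc_orIl. Qed.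

Lemma der_orIr G a b : der G b -> der G (or a b).
Proof. by apply: der_mp; apply/der_ipc/ipc_orIr. Qed.

Lemma der_orE G a b c :
  der G (or a b) -> der (add G a) c -> der (add G b) c -> der G c.
Proof.
move=> dab /deduction dac /deduction dbc.
apply: der_mp dab; apply: der_mp dbc; apply: der_mp dac.
exact/der_ipc/ipc_orE.
Qed.

Lemma der_botE G a : der G (bot L) -> der G a.
Proof. by apply: der_mp; apply/der_ipc/ipc_botE. Qed.

Lemma der_topI G : der G (top L).
Proof. exact/der_ipc/ipc_topI. Qed.

Lemma thm_imp a b : der (add (fun=> False) a) b -> thm (imp a b).
Proof. by move=> /deduction /thm_der. Qed.

End Derivations.

(** * Kripke models *)

(** The order is only a preorder: in the amalgam below, distinct worlds with
    the same theory lie below each other.  The field [acc_up] lets a refutation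
    of [Box (a --> b)] be witnessed directly by an accessible world that forces
    [a] and not [b]. *)
Record model := Model {
  world :> Type;
  le : world -> world -> Prop;
  acc : world -> world -> Prop;
  atom : world -> var -> Prop;
  le_refl : forall w, le w w;
  le_trans : forall u v w, le u v -> le v w -> le u w;
  acc_le : forall u v, acc u v -> le u v;
  le_acc : forall u v w, le u v -> acc v w -> acc u w;
  acc_up : forall u v w, acc u v -> le v w -> acc u w;
  atom_le : forall u v x, le u v -> atom u x -> atom v x;
  acc_wf : well_founded (fun u v => acc v u)
}.

Fixpoint force (M : model) (w : M) (f : formB) : Prop :=
  match f with
  | VarB x => atom w x
  | TopB => True
  | BotB => False
  | AndB a b => force w a /\ force w b
  | OrB a b => force w a \/ force w b
  | ImpB a b => forall v : M, le w v -> force v a -> force v b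
  | BoxB a => forall v : M, acc w v -> force v a
  end.

Definition valid f := forall (M : model) (w : M), force w f.

Section Forcing.
Context (M : model).
Implicit Types (u v w : M) (f : formB).

Lemma force_le f u v : le u v -> force u f -> force v f.
Proof.
elim: f u v => [x|||a IHa b IHb|a IHa b IHb|a IHa b IHb|a IHa] u v uv //=.
- exact: atom_le.
- by case=> [/(IHa _ _ uv) ? /(IHb _ _ uv)].
- by case=> [/(IHa _ _ uv)|/(IHb _ _ uv)]; [left|right].
- by move=> H w vw; apply: H; apply: le_trans vw.
- by move=> H w vw; apply: H; apply: le_acc vw.
Qed.

Lemma not_force_imp w a b : ~ force w (ImpB a b) ->
  exists v, [/\ le w v, force v a & ~ force v b].
Proof.
move=> /= H; apply: contrapT => N; apply: H => v wv va.
by apply: contrapT => vb; apply: N; exists v.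
Qed.

(** Converse well-foundedness yields a last accessible world refuting [a].
    That this world forces [BoxB a] is the semantic content of the Löb
    scheme. *)
Lemma not_force_box w a : ~ force w (BoxB a) ->
  exists v, [/\ acc w v, force v (BoxB a) & ~ force v a].
Proof.
elim/(well_founded_ind (@acc_wf M)): w => w IH /= H.
apply: contrapT => N; apply: H => v wv; apply: contrapT => va.
have [vB|/(IH v wv) [u [vu uB ua]]] := EM (force v (BoxB a)).
  by apply: N; exists v.
by apply: N; exists u; split=> //; apply: le_acc (acc_le wv) vu.
Qed.

End Forcing.

Lemma valid_imp a b :
  valid (ImpB a b) <-> forall (M : model) (w : M), force w a -> force w b.
Proof.
split=> H M w; first by move=> wa; apply: (H M w w) => //; apply: le_refl.
by move=> v _; apply: H.
Qed.

(** * Soundness and completeness *)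

Lemma valid_ipc f : ipcB f -> valid f.
Proof.
case=> {f} // [a b|a b c|a b|a b|a b|a b|a b|a b c|a].
all: apply/valid_imp => M w; try by case.
- by move=> wa v wv _; apply: force_le wa.
- move=> /= H v wv Hab u vu ua.
  have wu := le_trans wv vu.
  by apply: (H u wu ua u (le_refl u)); apply: Hab.
- by move=> wa v wv vb; split=> //; apply: force_le wa.
- by left.
- by right.
- move=> /= Hac v wv Hbc u vu [ua|ub]; last exact: Hbc.
  by apply: Hac ua; apply: le_trans vu.
Qed.

Lemma valid_SL p : valid (ImpB (ImpB (BoxB p) p) p).
Proof.
apply/valid_imp => M w H; apply: contrapT => wp.
have: ~ force w (BoxB p) by move=> wB; apply: wp (H w (le_refl w) wB).
by case/not_force_box=> v [wv vB]; apply; apply: H vB; apply: acc_le.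
Qed.

Lemma valid_mp a b : valid (ImpB a b) -> valid a -> valid b.
Proof. by move=> /valid_imp H Ha M w; apply: H. Qed.

Lemma iSLbox_sound f : iSLbox f -> valid f.
Proof.
elim=> {f} [f [p]|f /valid_ipc //|a b _ Hab _ Ha|a _ Ha|a b].
- exact: valid_SL.
- exact: valid_mp Hab Ha.
- by move=> M w v _; apply: Ha.
- apply/valid_imp => M w Hab v wv Ha u vu.
  apply: (Hab u _ u (le_refl u)); last exact: Ha.
  exact: le_acc vu.
Qed.

Canonical logicB := Logic (@iK_ipc iSLbox_axiom) (@iK_mp iSLbox_axiom).

Notation derB := (@der logicB).

(** Boxing all hypotheses of a derivation; iterated use of the K scheme. *)
Lemma derB_box G H f :
  (forall g, G g -> derB H (BoxB g)) -> derB G f -> derB H (BoxB f).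
Proof.
move=> GH; elim=> {f} [f thf|f /GH //|a b _ IHab _ IHa].
  by apply/der_thm/iK_nec.
by apply: der_mp IHa; apply: der_mp IHab; apply/der_thm/iK_K.
Qed.

Lemma derB_lob G f : derB (add G (BoxB f)) f -> derB G f.
Proof.
by move=> /deduction D; apply: der_mp D; apply/der_thm/iK_ax.
Qed.

(** Truth implies provability: apply the strong Löb rule to the conjunction of
    [f] with [BoxB f]. *)
Lemma derB_strong G f : derB G f -> derB G (BoxB f).
Proof.
move=> Gf; apply: (@der_andEr logicB _ f).
apply: derB_lob; apply: der_andI; first exact: der_addW.
apply: (@derB_box (eq (AndB f (BoxB f)))) => [_ <-|].
  exact: der_add.
by apply: (@der_andEl logicB _ _ (BoxB f)); apply: der_hyp.
Qed.

(** The formulas of [l] are decided one at a time; a formula is added unless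
    that would make [c] derivable.  A finite [l] suffices since the canonical
    model is built for the subformulas of one formula. *)
Lemma lindenbaum (l : seq formB) G c : ~ derB G c ->
  exists H, [/\ forall f, G f -> H f, ~ derB H c &
     forall f, f \in l -> H f \/ derB (add H f) c].
Proof.
move=> Gc; elim: l => [|f l [H [GH Hc Hl]]]; first by exists G; split.
have [Hf|Hf] := EM (derB (add H f) c).
  by exists H; split=> // g /[!inE] /predU1P[->|/Hl //]; right.
exists (add H f); split=> // [g /GH|g]; first by left.
rewrite inE => /predU1P[->|/Hl[Hg|Hg]]; first by left; right.
  by left; left.
right; apply: der_weak Hg => h [Hh|->]; first by left; left.
by right.
Qed.


Fixpoint sub f : seq formB :=
  f :: match f with
       | AndB a b | OrB a b | ImpB a b => sub a ++ sub b
       | BoxB a => sub a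
       | _ => [::]
       end.

Definition subclosed (S : seq formB) := forall f, f \in S ->
  match f with
  | AndB a b | OrB a b | ImpB a b => a \in S /\ b \in S
  | BoxB a => a \in S
  | _ => True
  end.

Lemma sub_refl f : f \in sub f.
Proof. by case: f => *; rewrite inE eqxx. Qed.

Lemma subclosed_cat S T : subclosed S -> subclosed T -> subclosed (S ++ T).
Proof.
move=> HS HT f; rewrite mem_cat => /orP[/HS|/HT]; case: f => //= *;
  rewrite !mem_cat; intuition; apply/orP; auto.
Qed.

Lemma subclosed_cons f S : subclosed S ->
  match f with
  | AndB a b | OrB a b | ImpB a b => a \in S /\ b \in S
  | BoxB a => a \in S
  | _ => True
  end -> subclosed (f :: S).
Proof.
move=> HS Hf g; rewrite inE => /orP[/eqP ->|/HS].
  by case: f Hf => //= *; rewrite !inE; intuition; apply/orP; auto.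
by case: g => //= *; rewrite !inE; intuition; apply/orP; auto.
Qed.

Lemma sub_closed f : subclosed (sub f).
Proof.
elim: f => [x|||a IHa b IHb|a IHa b IHb|a IHa b IHb|a IHa];
  apply: subclosed_cons => //; try exact: subclosed_cat;
  by rewrite ?mem_cat ?sub_refl ?orbT.
Qed.

(** The measure that decreases when a theory grows strictly. *)
Definition defect (S : seq formB) (P : formB -> Prop) :=
  count (fun f => ~~ `[< P f >]) S.

Lemma defect_le S (P P' : formB -> Prop) :
  (forall g, g \in S -> P g -> P' g) -> defect S P' <= defect S P.
Proof.
elim: S => //= a S IH PP'; apply: leq_add; last first.
  by apply: IH => g gS; apply: PP'; rewrite inE gS orbT.
case: asboolP => // P'a; case: asboolP => // Pa; case: P'a.
by apply: PP' Pa; rewrite inE eqxx.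
Qed.

Lemma defect_lt S (P P' : formB -> Prop) f :
  (forall g, g \in S -> P g -> P' g) -> f \in S -> P' f -> ~ P f ->
  defect S P' < defect S P.
Proof.
elim: S => //= a S IH PP'; rewrite inE => fS P'f Pf.
have {}IH : f \in S -> defect S P' < defect S P.
  by move=> ?; apply: IH => // g gS; apply: PP'; rewrite inE gS orbT.
have le : defect S P' <= defect S P.
  by apply: defect_le => g gS; apply: PP'; rewrite inE gS orbT.
case/orP: fS => [/eqP <-|/IH lt].
  by rewrite (asboolT P'f) (asboolF Pf) /= add0n add1n ltnS.
have le1 : ~~ `[< P' a >] <= ~~ `[< P a >].
  case: asboolP => // P'a; case: asboolP => // Pa; case: P'a.
  by apply: PP' Pa; rewrite inE eqxx.
by rewrite -addnS; apply: leq_add.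
Qed.

Section Canonical.
Context (S : seq formB) (Scl : subclosed S).

Definition saturated (G : formB -> Prop) :=
  [/\ forall f, f \in S -> derB G f -> G f,
      forall a b, OrB a b \in S -> G (OrB a b) -> G a \/ G b
    & ~ derB G BotB].

Definition theory := {G | saturated G}.

Lemma saturate G c : ~ derB G c ->
  exists w : theory, (forall f, G f -> sval w f) /\ ~ derB (sval w) c.
Proof.
case/(lindenbaum S)=> H [GH Hc HS].
suff sat : saturated H by exists (exist _ H sat).
split=> [f fS Hf|a b abS Hab|/der_botE //].
  have [//|/deduction Hfc] := HS f fS.
  by case: Hc; apply: der_mp Hfc Hf.
have [aS bS] := Scl abS.
have [Ha|Ha] := HS a aS; first by left.
have [Hb|Hb] := HS b bS; first by right.
by case: Hc; apply: (@der_orE logicB _ a b) => //; apply: der_hyp.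
Qed.

(** The last clause makes accessibility conversely well founded: each step
    puts a new boxed formula of [S] into the theory. *)
Definition theory_acc (w v : theory) :=
  [/\ forall f, sval w f -> sval v f,
      forall f, BoxB f \in S -> sval w (BoxB f) -> sval v f
    & exists f, [/\ BoxB f \in S, sval v (BoxB f) & ~ sval w (BoxB f)]].

Lemma theory_acc_wf : well_founded (fun w v : theory => theory_acc v w).
Proof.
pose missing (w : theory) := defect S (sval w).
apply: (@wf_incl _ _ (ltof _ missing)); last exact: well_founded_ltof.
move=> w v [vw _ [f [fS wf vf]]]; apply/ltP.
exact: (@defect_lt _ _ _ (BoxB f) (fun g _ => vw g) fS wf vf).
Qed.

Definition canonical_model : model.
Proof.
refine (@Model theory (fun w v => forall f, sval w f -> sval v f) theory_acc
  (fun w x => sval w (VarB x)) _ _ _ _ _ _ theory_acc_wf) => //.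
- by move=> u v w uv vw f /uv /vw.
- by move=> u v [].
- move=> u v w uv [vw vB [f [fS wf vf]]]; split; first by move=> g /uv /vw.
    by move=> g gS /uv; apply: vB.
  by exists f; split=> // /uv.
- move=> u v w [uv uB [f [fS wf vf]]] vw; split; first by move=> g /uv /vw.
    by move=> g gS /(uB _ gS) /vw.
  by exists f; split=> //; apply: vw.
- by move=> u v x uv /uv.
Defined.

Lemma truth f (w : canonical_model) : f \in S -> force w f <-> sval w f.
Proof.
elim: f w => [x|||a IHa b IHb|a IHa b IHb|a IHa b IHb|a IHa] w fS //=;
  have [wcl wor wbot] := svalP w; have := Scl fS.
- by split=> // _; apply: wcl => //; apply: der_topI.
- by split=> // ?; apply: wbot; apply: der_hyp.
- case=> aS bS; rewrite IHa // IHb //; split=> [[wa wb]|wab].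
    by apply: wcl => //; apply: der_andI; apply: der_hyp.
  have /(@der_hyp logicB) wab' := wab.
  by split; apply: wcl => //; [apply: der_andEl wab'|apply: der_andEr wab'].
- case=> aS bS; rewrite IHa // IHb //; split=> [wab|]; last exact: wor.
  by apply: wcl => //; case: wab => ?; [apply: der_orIl|apply: der_orIr];
    apply: der_hyp.
- case=> aS bS; split=> [H|wab v wv].
    apply: contrapT => wab.
    have /saturate [v [wv vb]] : ~ derB (add (sval w) a) b.
      by move=> /deduction D; apply: wab; apply: wcl.
    apply: vb; apply: der_hyp; apply/IHb => //; apply: H.
      by move=> f wf; apply: wv; left.
    by apply/IHa => //; apply: wv; right.
  rewrite IHa // IHb // => va; have [vcl _ _] := svalP v.
  by apply: vcl => //; apply: der_mp (der_hyp va); apply/der_hyp/wv.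
- move=> aS; split=> [H|wa v [_ vB _]]; last by apply/IHa => //; apply: vB.
  apply: contrapT => wa.
  (* The boxed formula itself is added, so that the world found is a proper
     successor; this costs nothing because of the strong rule [derB_lob]. *)
  pose G g := sval w g \/ BoxB g \in S /\ sval w (BoxB g).
  have /saturate [v [wv vb]] : ~ derB (add G (BoxB a)) a.
    move=> /derB_lob D; apply: wa; apply: wcl => //.
    apply: derB_box D => g [wg|[_ wg]]; last exact: der_hyp.
    exact/derB_strong/der_hyp.
  apply: vb; apply: der_hyp; apply/IHa => //; apply: H; split.
  + by move=> f wf; apply: wv; left; left.
  + by move=> f fS' wf; apply: wv; left; right.
  + by exists a; split=> //; apply: wv; right.
Qed.

End Canonical.

Lemma iSLboxP f : iSLbox f <-> valid f.
Proof.
split; first exact: iSLbox_sound.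
move=> vf; apply: contrapT => nf.
have [|w [_ wf]] := @saturate _ (@sub_closed f) (fun=> False) f.
  by move=> /thm_der.
apply: wf; apply: der_hyp.
by apply/(truth (@sub_closed f) w (sub_refl f))/vf.
Qed.

(** * Bounded equivalence of worlds *)

(** All ways to divide [l] into formulas to be forced and formulas not to be
    forced, recorded as the conjunction of the former and the disjunction of
    the latter.  A negated formula would not do, since intuitionistically not
    forcing differs from forcing the negation. *)
Fixpoint cells (l : seq formB) : seq (formB * formB) :=
  if l is f :: l' then
    [seq (AndB f c.1, c.2) | c <- cells l'] ++
    [seq (c.1, OrB f c.2) | c <- cells l']
  else [:: (TopB, BotB)].

Definition in_cell (M : model) (w : M) (c : formB * formB) :=
  force w c.1 /\ ~ force w c.2.

Lemma cell_exists l (M : model) (w : M) :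
  exists2 c, c \in cells l & in_cell w c.
Proof.
elim: l => [|f l [c cl [w1 w2]]].
  by exists (TopB, BotB); [rewrite inE|split].
have [wf|wf] := EM (force w f).
  exists (AndB f c.1, c.2); last by split.
  by rewrite mem_cat map_f.
exists (c.1, OrB f c.2); last by split=> //= -[].
by rewrite mem_cat orbC (map_f (fun c => (c.1, OrB f c.2))).
Qed.

Definition agree (l : seq formB) (K M : model) (k : K) (m : M) :=
  forall f, f \in l -> force k f <-> force m f.

Lemma agree_sym l (K M : model) (k : K) (m : M) : agree l k m -> agree l m k.
Proof. by move=> H f fl; rewrite H. Qed.

Lemma cell_agree l c (K M : model) (k : K) (m : M) :
  c \in cells l -> in_cell k c -> in_cell m c -> agree l k m.
Proof.
elim: l c => //= f l IH c; rewrite mem_cat.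
by case/orP=> /mapP[{}c cl ->] [/= k1 k2] [/= m1 m2] g; rewrite inE;
  case/predU1P=> [->|]; try tauto; apply: (IH c cl); split; tauto.
Qed.

Definition cell_imps l := [seq ImpB c.1 c.2 | c <- cells l].

(** A world fails [ImpB a b] exactly when some world above it lies in the cell
    [(a, b)], and it fails the boxed implication exactly when some accessible
    world does.  So a layer says which cells of the preceding layer are
    reachable along each of the two relations. *)
Fixpoint layer (Q : seq var) (n : nat) : seq formB :=
  if n is n'.+1 then
    layer Q n' ++ cell_imps (layer Q n') ++ map BoxB (cell_imps (layer Q n'))
  else map VarB Q.

Lemma layer_sub Q n n' f : n <= n' -> f \in layer Q n -> f \in layer Q n'.
Proof.
elim: n' => [|n' IH]; first by rewrite leqn0 => /eqP ->.
rewrite leq_eqVlt => /predU1P[-> //|/IH {}IH /IH fn] /=.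
by rewrite mem_cat fn.
Qed.

Lemma agree_layer_le Q n n' (K M : model) (k : K) (m : M) :
  n <= n' -> agree (layer Q n') k m -> agree (layer Q n) k m.
Proof. by move=> nn' H f /(layer_sub nn') fl; apply: H. Qed.

Lemma agree_le Q n (K M : model) (k k' : K) (m : M) :
  agree (layer Q n.+1) k m -> le k k' ->
  exists2 m', le m m' & agree (layer Q n) k' m'.
Proof.
move=> km kk'; have [c cl kc] := cell_exists (layer Q n) k'.
have cn : ImpB c.1 c.2 \in layer Q n.+1.
  by rewrite /= !mem_cat (map_f (fun c => ImpB c.1 c.2)) // orbT.
have : ~ force m (ImpB c.1 c.2).
  by rewrite -(km _ cn) => /= H; apply: kc.2; apply: H kk' kc.1.
case/not_force_imp=> m' [mm' m1 m2]; exists m' => //.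
exact: cell_agree cl kc _.
Qed.

Lemma agree_acc Q n (K M : model) (k k' : K) (m : M) :
  agree (layer Q n.+1) k m -> acc k k' ->
  exists2 m', acc m m' & agree (layer Q n) k' m'.
Proof.
move=> km kk'; have [c cl kc] := cell_exists (layer Q n) k'.
have cn : BoxB (ImpB c.1 c.2) \in layer Q n.+1.
  by rewrite /= !mem_cat map_f ?orbT // (map_f (fun c => ImpB c.1 c.2)).
have : ~ force m (BoxB (ImpB c.1 c.2)).
  rewrite -(km _ cn) => /= H; apply: kc.2; apply: H kk' _ (le_refl k') kc.1.
case/not_force_box=> m1 [mm1 _ /not_force_imp[m' [m1m' mc1 mc2]]].
exists m'; first exact: acc_up m1m'.
exact: cell_agree cl kc _.
Qed.

Lemma agree_of_le Q n (K M : model) (k : K) (m m' : M) :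
  agree (layer Q n.+1) k m -> le m m' ->
  exists2 k', le k k' & agree (layer Q n) k' m'.
Proof.
move=> km mm'; have [k' kk' m'k'] := agree_le (agree_sym km) mm'.
by exists k' => //; apply: agree_sym.
Qed.

Lemma agree_of_acc Q n (K M : model) (k : K) (m m' : M) :
  agree (layer Q n.+1) k m -> acc m m' ->
  exists2 k', acc k k' & agree (layer Q n) k' m'.
Proof.
move=> km mm'; have [k' kk' m'k'] := agree_acc (agree_sym km) mm'.
by exists k' => //; apply: agree_sym.
Qed.

(** * Amalgamation *)

Section Amalgam.
Context (K M : model) (S : seq formB) (Q : seq var) (q : {fset var}).
Hypothesis Scl : subclosed S.
Hypothesis SQ : forall x, VarB x \in S -> x \notin q -> x \in Q.
Implicit Types (k : K) (m : M).

(** The worlds of the amalgam are pairs [(k, m)] of linked worlds.  In the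
    first component only the [S]-theory of [k] matters, so pairs are ordered by
    inclusion of theories there and by the order of [M] in the second. *)
Definition theory_le k k' := forall f, f \in S -> force k f -> force k' f.
Definition rank k := defect S (force k).

(** Linking must survive two kinds of moves.  A move of [m] has to be answered
    by [K], and may leave the theory of [k] unchanged arbitrarily often, so it
    must not consume agreement each time.  This is why a link refers to an
    earlier pair [(k0, m0)] with the same theory and one more level of
    agreement: every such move is answered afresh from [k0].  A move of [k] has
    to be answered by [M] only if it enlarges the theory; then the rank drops,
    which pays for two levels of agreement. *)
Definition linked k m := exists k0 m0,
  [/\ le k0 k, le m0 m, theory_le k k0,
      agree (layer Q (rank k).*2.+1) k0 m0 & agree (layer Q (rank k).*2) k m].

Lemma linked_base k m : agree (layer Q (rank k).*2.+1) k m -> linked k m.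
Proof.
move=> km; exists k, m; split=> //; try exact: le_refl.
exact: agree_layer_le km.
Qed.

Lemma rank_le k k' : theory_le k k' -> rank k' <= rank k.
Proof. exact: defect_le. Qed.

Lemma le_theory k k' : le k k' -> theory_le k k'.
Proof. by move=> kk' f _; apply: force_le. Qed.

Lemma rank_eq k k' : le k k' -> theory_le k' k -> rank k = rank k'.
Proof.
move=> /le_theory/rank_le le1 /rank_le le2.
by apply/eqP; rewrite eqn_leq le1 le2.
Qed.

Lemma rank_lt k k' : theory_le k k' -> ~ theory_le k' k -> rank k' < rank k.
Proof.
move=> kk' /existsNP[f /not_implyP[fS /not_implyP[k'f kf]]].
exact: defect_lt kk' fS k'f kf.
Qed.

(** After a strict growth of the theory the rank is at most [rank k - 1], and
    the level demanded by [linked_base] is at most [2 * rank k - 1]. *)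
Lemma linked_above k k' m' :
  theory_le k k' -> ~ theory_le k' k ->
  agree (layer Q (rank k).*2.-1) k' m' -> linked k' m'.
Proof.
move=> kk' /(rank_lt kk') lt k'm'.
apply: linked_base; apply: agree_layer_le k'm'.
rewrite -ltnS; case: (rank k) lt => // r.
by rewrite doubleS /= !ltnS leq_double.
Qed.

(** Either the theory is still that of [k0], and [(k0, m0)] keeps serving as
    reference pair, or it has grown and [(k', m')] can start anew. *)
Lemma linked_forth k k0 m0 k' m' :
  le k0 k' -> le m0 m' -> rank k0 = rank k -> theory_le k k0 ->
  agree (layer Q (rank k).*2.+1) k0 m0 -> agree (layer Q (rank k).*2) k' m' ->
  linked k' m'.
Proof.
move=> kk' mm' rk kk0 km k'm'.
have [H|H] := EM (theory_le k' k0).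
  have r' : rank k' = rank k by rewrite -rk (rank_eq kk').
  by exists k0, m0; rewrite r'; split.
apply: (@linked_above k0) => //; first exact: le_theory.
rewrite rk; apply: agree_layer_le k'm'; exact: leq_pred.
Qed.

Lemma linked_le k m m' : linked k m -> le m m' ->
  exists2 k', theory_le k k' & linked k' m'.
Proof.
case=> k0 [m0 [k0k m0m kk0 k0m0 km]] mm'.
have m0m' := le_trans m0m mm'.
have [k' k0k' k'm'] := agree_of_le k0m0 m0m'.
exists k'; first by move=> f fS /(kk0 f fS); apply: le_theory.
exact: linked_forth k0k' m0m' (rank_eq k0k kk0) kk0 k0m0 k'm'.
Qed.

(** What remains of the accessibility relation of [K] once worlds are
    identified with their theories. *)
Definition theory_acc_le k k' := theory_le k k' /\
  forall f, BoxB f \in S -> force k (BoxB f) -> force k' f.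

Lemma acc_theory k k' : acc k k' -> theory_acc_le k k'.
Proof.
move=> kk'; split; first exact/le_theory/acc_le.
by move=> f _; apply.
Qed.

Lemma linked_acc k m m' : linked k m -> acc m m' ->
  exists2 k', theory_acc_le k k' & linked k' m'.
Proof.
case=> k0 [m0 [k0k m0m kk0 k0m0 km]] mm'.
have m0m' := le_acc m0m mm'.
have [k' k0k' k'm'] := agree_of_acc k0m0 m0m'.
exists k'.
  have [k0k'l k0k'B] := acc_theory k0k'.
  split; first by move=> f fS /(kk0 f fS); apply: k0k'l.
  by move=> f fS /(kk0 _ fS); apply: k0k'B.
exact: linked_forth (acc_le k0k') (acc_le m0m') (rank_eq k0k kk0) kk0 k0m0 k'm'.
Qed.

Lemma linked_agree k m k' : linked k m -> rank k' < rank k ->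
  agree (layer Q (rank k).*2.-1.+1) k m.
Proof.
case=> k0 [m0 [_ _ _ _ km]] lt.
by rewrite prednK // double_gt0; apply: leq_ltn_trans lt.
Qed.

Lemma linked_le_above k m k' : linked k m -> le k k' -> ~ theory_le k' k ->
  exists2 m', le m m' & linked k' m'.
Proof.
move=> km kk' nk; have lt := rank_lt (le_theory kk') nk.
have [m' mm' km'] := agree_le (linked_agree km lt) kk'.
by exists m' => //; apply: linked_above km' => //; apply: le_theory.
Qed.

Lemma linked_acc_above k m k' : linked k m -> acc k k' -> ~ theory_le k' k ->
  exists2 m', acc m m' & linked k' m'.
Proof.
move=> km kk' nk; have lt := rank_lt (le_theory (acc_le kk')) nk.
have [m' mm' km'] := agree_acc (linked_agree km lt) kk'.
by exists m' => //; apply: linked_above km' => //; apply/le_theory/acc_le.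
Qed.

(** Variables of [q] are read in [K] and all others in [M].  Well-foundedness
    is inherited from [M] by projection, so a step may leave the theory of the
    first component unchanged. *)
Definition amalgam : model.
Proof.
refine (@Model {p : K * M | linked p.1 p.2}
  (fun u v => theory_le (sval u).1 (sval v).1 /\ le (sval u).2 (sval v).2)
  (fun u v => theory_acc_le (sval u).1 (sval v).1 /\ acc (sval u).2 (sval v).2)
  (fun u x => if x \in q then VarB x \in S /\ force (sval u).1 (VarB x)
              else force (sval u).2 (VarB x))
  _ _ _ _ _ _ _).
- by move=> u; split=> //; apply: le_refl.
- move=> u v w [uv1 uv2] [vw1 vw2]; split; last exact: le_trans vw2.
  by move=> f fS /(uv1 f fS) /(vw1 f fS).
- by move=> u v [[uv _] /acc_le].
- move=> u v w [uv1 uv2] [[vw1 vwB] vw2]; split; last exact: le_acc vw2.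
  split; first by move=> f fS /(uv1 f fS) /(vw1 f fS).
  by move=> f fS /(uv1 _ fS) /(vwB f fS).
- move=> u v w [[uv1 uvB] uv2] [vw1 vw2]; split; last exact: acc_up vw2.
  split; first by move=> f fS /(uv1 f fS) /(vw1 f fS).
  by move=> f fS /(uvB _ fS); apply: vw1; apply: Scl fS.
- move=> u v x [uv1 uv2]; case: ifP => _; last exact: force_le.
  by case=> xS ux; split=> //; apply: uv1.
- apply: (@wf_incl _ _ (fun u v => acc (sval v).2 (sval u).2)).
    by move=> u v [].
  exact: (wf_inverse_image _ _ _ _ (@acc_wf M)).
Defined.

(** The projection to [M] is a bounded morphism for the variables outside
    [q]. *)
Lemma amalgam_right f (w : amalgam) : (forall x, x \in PVB f -> x \notin q) ->
  force w f <-> force (sval w).2 f.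
Proof.
elim: f w => [x|||a IHa b IHb|a IHa b IHb|a IHa b IHb|a IHa] w /= Hf //.
- by rewrite (negbTE (Hf x _)) // in_fset1.
all: try have Ha x (xa : x \in PVB a) : x \notin q by
  apply: Hf; rewrite ?in_fsetU ?xa.
all: try have Hb x (xb : x \in PVB b) : x \notin q by
  apply: Hf; rewrite ?in_fsetU ?xb ?orbT.
- by rewrite IHa ?IHb.
- by rewrite IHa ?IHb.
- split=> [H m' wm' ma|H v [_ wv]]; last by rewrite IHa // IHb //; apply: H.
  have [k' kk' km'] := linked_le (svalP w) wm'.
  pose v : amalgam := exist _ (k', m') km'.
  by have := H v; rewrite IHa // IHb //; apply.
- split=> [H m' wm'|H v [_ wv]]; last by rewrite IHa //; apply: H.
  have [k' kk' km'] := linked_acc (svalP w) wm'.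
  pose v : amalgam := exist _ (k', m') km'.
  by have := H v; rewrite IHa //; apply.
Qed.

(** When an implication fails at [k], either a witness has the theory of [k],
    and then the pair itself is a witness, or the theory grows and the step is
    matched in [M].  When a boxed formula fails, the witness may be taken to
    force the boxed formula, so its theory is always larger. *)
Lemma amalgam_left f (w : amalgam) : f \in S ->
  force w f <-> force (sval w).1 f.
Proof.
elim: f w => [x|||a IHa b IHb|a IHa b IHb|a IHa b IHb|a IHa] [[k m] km] fS //=;
  have := Scl fS.
- move=> _; case: ifP => xq; first by split=> // -[].
  have [k0 [m0 [_ _ _ _ /agree_layer_le]]] := km.
  move=> /(_ 0 (leq0n _)) /(_ (VarB x)) E; symmetry; apply: E.
  by apply: map_f; apply: SQ; rewrite ?xq.
- by case=> aS bS; rewrite IHa // IHb.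
- by case=> aS bS; rewrite IHa // IHb.
- case=> aS bS; split=> [H|H v [wv _]]; last first.
    rewrite IHa // IHb // => va.
    have := wv _ fS H; apply; [exact: le_refl|exact: va].
  apply: contrapT => /not_force_imp[k' [kk' ka kb]].
  have [H'|H'] := EM (theory_le k' k).
    apply: kb; apply: force_le kk' _; apply/(IHb (exist _ (k, m) km)) => //.
    apply: H; first by split=> //; apply: le_refl.
    by apply/IHa => //; apply: H'.
  have [m' mm' km'] := linked_le_above km kk' H'.
  apply/kb/(IHb (exist _ (k', m') km')) => //; apply: H.
    by split=> //; apply: le_theory.
  exact/IHa.
- move=> aS; split=> [H|H v [[_ wv] _]]; last by rewrite IHa //; apply: wv.
  apply: contrapT => /not_force_box[k' [kk' kB ka]].
  have H' : ~ theory_le k' k by move=> /(_ _ fS kB) /(_ k' kk').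
  have [m' mm' km'] := linked_acc_above km kk' H'.
  apply/ka/(IHa (exist _ (k', m') km')) => //; apply: H.
  by split=> //; apply: acc_theory.
Qed.

End Amalgam.

Lemma amalgamation (K M : model) (k : K) (m : M) S Q (q : {fset var}) :
    subclosed S -> (forall x, VarB x \in S -> x \notin q -> x \in Q) ->
    agree (layer Q (size S).*2.+1) k m ->
  exists (N : model) (w : N),
    (forall f, f \in S -> force w f <-> force k f) /\
    (forall f, (forall x, x \in PVB f -> x \notin q) ->
       force w f <-> force m f).
Proof.
move=> Scl SQ km.
have lk : linked S Q k m.
  by apply/linked_base/agree_layer_le/km; rewrite ltnS leq_double count_size.
exists (@amalgam K M S Q q Scl), (exist _ (k, m) lk).
by split=> f Hf; [rewrite amalgam_left|rewrite amalgam_right].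
Qed.

(** * Uniform interpolants in the box language *)

Definition bigand (l : seq formB) := foldr AndB TopB l.

Lemma force_bigand (M : model) (w : M) l :
  force w (bigand l) <-> forall f, f \in l -> force w f.
Proof.
elim: l => [|f l IH] /=; first by split.
rewrite IH; split=> [[wf wl] g|H].
  by rewrite inE => /predU1P[->|/wl].
by split=> [|g gl]; apply: H; rewrite inE ?eqxx ?gl ?orbT.
Qed.

Definition pv_over (Q : {fset var}) (l : seq formB) :=
  forall f, f \in l -> PVB f `<=` Q.

Lemma pv_bigand Q l : pv_over Q l -> PVB (bigand l) `<=` Q.
Proof.
elim: l => [|f l IH] H /=; first exact: fsub0set.
rewrite fsubUset H ?inE ?eqxx //= IH // => g gl.
by apply: H; rewrite inE gl orbT.
Qed.

Lemma pv_cells Q l c : pv_over Q l -> c \in cells l ->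
  (PVB c.1 `<=` Q) && (PVB c.2 `<=` Q).
Proof.
elim: l c => [|f l IH] c H /=.
  by rewrite inE => /eqP -> /=; rewrite !fsub0set.
have {}IH d : d \in cells l -> (PVB d.1 `<=` Q) && (PVB d.2 `<=` Q).
  by apply: IH => g gl; apply: H; rewrite inE gl orbT.
have Hf : PVB f `<=` Q by apply: H; rewrite inE eqxx.
by rewrite mem_cat => /orP[] /mapP[d /IH /andP[d1 d2] ->] /=;
  rewrite fsubUset ?Hf ?d1 ?d2.
Qed.

Lemma pv_cell_imps Q l : pv_over Q l -> pv_over Q (cell_imps l).
Proof.
move=> H f /mapP[c /(pv_cells H) /andP[c1 c2] ->] /=.
by rewrite fsubUset c1 c2.
Qed.

Lemma pv_layer (Q : {fset var}) n : pv_over Q (layer (enum_fset Q) n).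
Proof.
elim: n => [|n IH] f /=.
  by move=> /mapP[x xQ ->] /=; rewrite fsub1set.
rewrite !mem_cat => /or3P[/IH //|/(pv_cell_imps IH) //|/mapP[g gl ->]].
exact: (pv_cell_imps IH gl).
Qed.

Lemma sub_pv f x : VarB x \in sub f -> x \in PVB f.
Proof.
elim: f => [y|||a IHa b IHb|a IHa b IHb|a IHa b IHb|a IHa] /=;
  rewrite in_cons => /predU1P[] //.
- by case=> ->; rewrite in_fset1.
all: by rewrite mem_cat in_fsetU => /orP[/IHa ->|/IHb ->]; rewrite ?orbT.
Qed.

Section Interpolants.
Context (p : formB) (q : {fset var}).

Let Q := PVB p `\` q.
(* Ranks are at most the size of [sub p], hence the level. *)
Let L := layer (enum_fset Q) (size (sub p)).*2.+1.

Definition select (P : formB * formB -> Prop) :=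
  bigand [seq ImpB c.1 c.2 | c <- cells L & `[< P c >]].

Lemma force_select P (M : model) (w : M) : force w (select P) <->
  forall c, c \in cells L -> P c -> forall v, le w v -> ~ in_cell v c.
Proof.
rewrite force_bigand; split=> [H c cL /asboolP Pc v wv [v1 v2]|H f].
  apply: v2; apply: (H (ImpB c.1 c.2)) wv v1.
  by apply: (map_f (fun c => ImpB c.1 c.2)); rewrite mem_filter Pc.
case/mapP=> c; rewrite mem_filter => /andP[/asboolP Pc cL] -> v wv v1.
by apply: contrapT => v2; apply: (H c cL Pc v wv).
Qed.

Lemma pv_select P : PVB (select P) `<=` Q.
Proof.
apply: pv_bigand => f /mapP[c]; rewrite mem_filter => /andP[_ cL] -> /=.
by have /andP[c1 c2] := pv_cells (@pv_layer Q _) cL; rewrite fsubUset c1.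
Qed.

Lemma cell_amalgamation (K M : model) (k : K) (m : M) c :
    c \in cells L -> in_cell k c -> in_cell m c ->
  exists (N : model) (w : N), (force w p <-> force k p) /\
    forall f, PVB f `&` q = fset0 -> force w f <-> force m f.
Proof.
move=> cL kc mc.
have SQ x : VarB x \in sub p -> x \notin q -> x \in enum_fset Q.
  by move=> /sub_pv xp xq; rewrite -/(x \in Q) in_fsetD xp xq.
have [N [w [wk wm]]] :=
  amalgamation (@sub_closed p) SQ (cell_agree cL kc mc).
exists N, w; split; first exact/wk/sub_refl.
move=> f fq; apply: wm => x xf; apply/negP => xq.
have : x \in PVB f `&` q by rewrite in_fsetI xf.
by rewrite fq in_fset0.
Qed.

Definition ex_interpolant :=
  select (fun c => valid (ImpB p (ImpB c.1 c.2))).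

Definition all_interpolant :=
  select (fun c => exists (K : model) (k : K), in_cell k c /\ ~ force k p).

(** If [m] forces the interpolant and refutes [r], its cell contains a world
    forcing [p]; amalgamating the two refutes [ImpB p r]. *)
Lemma valid_ex r : PVB r `&` q = fset0 ->
  valid (ImpB p r) <-> valid (ImpB ex_interpolant r).
Proof.
move=> rq; split=> /valid_imp H; apply/valid_imp => M m Hm; last first.
  apply: H; apply/force_select => c cL /valid_imp pc v mv [v1 v2].
  exact: v2 (pc _ _ Hm v mv v1).
apply: contrapT => mr; have [c cL mc] := cell_exists L m.
have : ~ valid (ImpB p (ImpB c.1 c.2)).
  by move=> pc; apply: (proj1 (force_select _ _) Hm c cL pc m (le_refl m) mc).
apply; apply/valid_imp => K k kp v kv v1; apply: contrapT => v2.
have [N [w [wp wf]]] := cell_amalgamation cL (conj v1 v2) mc.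
apply/mr/wf => //; apply: H; apply/wp; exact: force_le kp.
Qed.

Lemma valid_all r : PVB r `&` q = fset0 ->
  valid (ImpB r p) <-> valid (ImpB r all_interpolant).
Proof.
move=> rq; split=> /valid_imp H; apply/valid_imp => M m Hm; last first.
  apply: contrapT => mp; have [c cL mc] := cell_exists L m.
  have /force_select sel := H M m Hm.
  by apply: (sel c cL _ m (le_refl m) mc); exists M, m.
apply/force_select => c cL [K [k [kc kp]]] v mv vc.
have [N [w [wp wf]]] := cell_amalgamation cL kc vc.
by apply/kp/wp/H/wf => //; apply: force_le Hm.
Qed.

End Interpolants.

Lemma iSLbox_uniform_interpolation : uniform_interpolation ImpB PVB iSLbox.
Proof.
move=> p q; exists (ex_interpolant p q), (all_interpolant p q).
split; try exact: pv_select.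
by move=> r rq; rewrite !iSLboxP; split; [apply: valid_ex|apply: valid_all].
Qed.

(** * The arrow as a boxed implication *)

Fixpoint toB (f : formA) : formB :=
  match f with
  | VarA x => VarB x
  | TopA => TopB
  | BotA => BotB
  | AndA a b => AndB (toB a) (toB b)
  | OrA a b => OrB (toB a) (toB b)
  | ImpA a b => ImpB (toB a) (toB b)
  | StrictA a b => BoxB (ImpB (toB a) (toB b))
  end.

Fixpoint toA (f : formB) : formA :=
  match f with
  | VarB x => VarA x
  | TopB => TopA
  | BotB => BotA
  | AndB a b => AndA (toA a) (toA b)
  | OrB a b => OrA (toA a) (toA b)
  | ImpB a b => ImpA (toA a) (toA b)
  | BoxB a => BoxA (toA a)
  end.

Lemma pv_toB f : PVB (toB f) = PVA f.
Proof. by elim: f => //= a -> b ->. Qed.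

Lemma pv_toA f : PVA (toA f) = PVB f.
Proof.
by elim: f => //= [a -> b ->|a -> b ->|a -> b ->|a ->]; rewrite ?fset0U.
Qed.

Lemma force_strict (M : model) (w : M) a b :
  force w (BoxB (ImpB a b)) <-> forall v, acc w v -> force v a -> force v b.
Proof.
split=> [H v wv|H v wv u vu]; first exact: (H v wv v (le_refl v)).
by apply: H; apply: acc_up vu.
Qed.

Lemma toB_toA f (M : model) (w : M) : force w (toB (toA f)) <-> force w f.
Proof.
elim: f w => [x|||a IHa b IHb|a IHa b IHb|a IHa b IHb|a IHa] w //=.
- by rewrite IHa IHb.
- by rewrite IHa IHb.
- by split=> H v wv /IHa va; apply/IHb/H.
- rewrite -/(force w (BoxB (ImpB TopB (toB (toA a))))) force_strict.
  by split=> H v wv; [apply/IHa/H|move=> _; apply/IHa/H].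
Qed.

(** Validity in models spares the derivation of each translated scheme in the
    box calculus. *)
Lemma toB_sound f : iSLa f -> iSLbox (toB f).
Proof.
move=> D; apply/iSLboxP; elim: D => {f}.
- move=> f [a|a b c] /=.
    apply/valid_imp => M w H; apply: (valid_SL (p := toB a)) (le_refl w) _.
    move=> v wv va; apply: H wv _ => u vu x ux _.
    by apply: force_le ux _; apply: va.
  apply/valid_imp => M w /force_strict H v wv u vu uc x ux xa.
  have wu := acc_up wv vu; have wx := acc_up wu ux.
  by apply: H wx _; split=> //; apply: force_le uc.
- by move=> f fax; apply: valid_ipc; case: fax => *; constructor.
- by move=> a b _ + _; apply: valid_mp.
- by move=> a b _ H M w v _; apply: H.
- move=> a b c; apply/valid_imp => M w [/force_strict ab /force_strict bc].
  by apply/force_strict => v wv /(ab v wv) /(bc v wv).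
- move=> a b c; apply/valid_imp => M w [/force_strict ab /force_strict ac].
  by apply/force_strict => v wv va; split; [apply: ab|apply: ac].
- move=> a b c; apply/valid_imp => M w [/force_strict ac /force_strict bc].
  by apply/force_strict => v wv [/ac|/bc]; apply.
Qed.

Canonical logicA := Logic (@HLC_ipc iSLa_axiom) (@HLC_mp iSLa_axiom).

Notation derA := (@der logicA).

Lemma derA_nec G a b : iSLa (ImpA a b) -> derA G (StrictA a b).
Proof. by move=> ab; apply/der_thm/HLC_nec. Qed.

Lemma derA_tr G a b c :
  derA G (StrictA a b) -> derA G (StrictA b c) -> derA G (StrictA a c).
Proof.
move=> ab bc; apply: (@der_mp logicA _ (AndA (StrictA a b) (StrictA b c))).
  exact/der_thm/HLC_tr.
exact: (@der_andI logicA).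
Qed.

Lemma derA_and G a b c :
  derA G (StrictA a b) -> derA G (StrictA a c) -> derA G (StrictA a (AndA b c)).
Proof.
move=> ab ac; apply: (@der_mp logicA _ (AndA (StrictA a b) (StrictA a c))).
  exact/der_thm/HLC_and.
exact: (@der_andI logicA).
Qed.

(** From left to right this is the additional scheme with [r := TopA]; the
    converse composes [a ~~> ((a --> b) /\ a)] with modus ponens under the
    arrow. *)
Lemma derA_strict_imp G a b : derA G (StrictA a b) <-> derA G (BoxA (ImpA a b)).
Proof.
split=> D.
  apply: (@der_mp logicA _ (StrictA (AndA TopA a) b)).
    exact/der_thm/HLC_ax/iSLa_imp.
  apply: derA_tr D; apply: derA_nec; apply: (@thm_imp logicA).
  exact: (@der_andEr logicA _ TopA _ (@der_add logicA _ _)).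
apply: (@derA_tr _ _ (AndA (ImpA a b) a)).
  apply: derA_and.
    apply: derA_tr D; apply: derA_nec; apply: (@thm_imp logicA).
    exact: (@der_topI logicA).
  by apply: derA_nec; apply: (@thm_imp logicA); apply: (@der_add logicA).
apply: derA_nec; apply: (@thm_imp logicA).
have h := @der_add logicA (fun=> False) (AndA (ImpA a b) a).
exact: (@der_mp logicA) (@der_andEl logicA _ _ _ h) (@der_andEr logicA _ _ _ h).
Qed.

Lemma toA_sound f : iSLbox f -> iSLa (toA f).
Proof.
elim=> {f} [f [p]|f fax|a b _ IHab _ IHa|a _ IHa|a b] /=.
- exact/HLC_ax/iSLa_SL.
- by apply: HLC_ipc; case: fax => *; constructor.
- exact: HLC_mp IHab IHa.
- by apply/HLC_nec/(@thm_imp logicA)/der_thm.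
- apply: (@thm_imp logicA); apply: (@deduction logicA).
  have [h h'] : let G := add (add (fun=> False) (BoxA (ImpA (toA a) (toA b))))
      (BoxA (toA a)) in
    derA G (StrictA (toA a) (toA b)) /\ derA G (BoxA (toA a)).
    by split; [apply/derA_strict_imp/der_addW|]; apply: (@der_add logicA).
  exact: derA_tr h' h.
Qed.

Lemma derA_imp_mono a a' b b' : iSLa (ImpA a' a) -> iSLa (ImpA b b') ->
  iSLa (ImpA (ImpA a b) (ImpA a' b')).
Proof.
move=> aa bb; apply: (@thm_imp logicA); apply: (@deduction logicA).
apply: der_mp (der_thm _ bb) _; apply: (@der_mp logicA _ a).
  by apply: der_addW; apply: (@der_add logicA).
exact: der_mp (der_thm _ aa) (@der_add logicA _ _).
Qed.

Lemma derA_strict_mono G a a' b b' : iSLa (ImpA a' a) -> iSLa (ImpA b b') ->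
  derA G (StrictA a b) -> derA G (StrictA a' b').
Proof.
move=> aa bb /(derA_tr (derA_nec G aa)) ab.
exact: derA_tr ab (derA_nec G bb).
Qed.

(** Both directions are proved together because implication and the arrow are
    antitone on the left. *)
Lemma toA_toB f : iSLa (ImpA f (toA (toB f))) /\ iSLa (ImpA (toA (toB f)) f).
Proof.
have refl a : iSLa (ImpA a a) by apply/(@thm_imp logicA)/(@der_add logicA).
elim: f => [x|||a [a1 a2] b [b1 b2]|a [a1 a2] b [b1 b2]|a [a1 a2] b [b1 b2]
           |a [a1 a2] b [b1 b2]] /=; try by split; apply: refl.
- have mono c c' d d' : iSLa (ImpA c c') -> iSLa (ImpA d d') ->
      iSLa (ImpA (AndA c d) (AndA c' d')).
    move=> cc dd; apply: (@thm_imp logicA).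
    have h := @der_add logicA (fun=> False) (AndA c d).
    apply: (@der_andI logicA).
      exact: der_mp (der_thm _ cc) (@der_andEl logicA _ _ _ h).
    exact: der_mp (der_thm _ dd) (@der_andEr logicA _ _ _ h).
  by split; apply: mono.
- have mono c c' d d' : iSLa (ImpA c c') -> iSLa (ImpA d d') ->
      iSLa (ImpA (OrA c d) (OrA c' d')).
    move=> cc dd; apply: (@thm_imp logicA).
    have h := @der_add logicA (fun=> False) (OrA c d).
    apply: (@der_orE logicA _ _ _ _ h).
      exact/(@der_orIl logicA)/(der_mp (der_thm _ cc))/(@der_add logicA).
    exact/(@der_orIr logicA)/(der_mp (der_thm _ dd))/(@der_add logicA).
  by split; apply: mono.
- by split; apply: derA_imp_mono.
- have h c := @der_add logicA (fun=> False) c.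
  split; apply: (@thm_imp logicA).
    by apply: (derA_strict_imp _ _ _).1; apply: derA_strict_mono a2 b1 (h _).
  apply: derA_strict_mono a1 b2 _.
  by apply: (derA_strict_imp _ _ _).2; apply: h.
Qed.

Lemma iSLa_toB f : iSLa f <-> iSLbox (toB f).
Proof.
split; first exact: toB_sound.
by move=> /toA_sound; apply: HLC_mp; case: (toA_toB f).
Qed.

Lemma iSLa_uniform_interpolation : uniform_interpolation ImpA PVA iSLa.
Proof.
move=> p q.
have [ex [all [exq allq H]]] := iSLbox_uniform_interpolation (toB p) q.
exists (toA ex), (toA all); rewrite !pv_toA -(pv_toB p); split=> // r rq.
have [Hex Hall] := H (toB r) (etrans (congr1 (fsetI^~ q) (pv_toB r)) rq).
rewrite !iSLa_toB /= Hex Hall !iSLboxP !valid_imp.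
by split; split=> V M w; move: (V M w); rewrite toB_toA.
Qed.

Theorem corollary5p9 :
  uniform_interpolation ImpA PVA iSLa /\
  uniform_interpolation ImpB PVB iSLbox.
Proof.
split; first exact: iSLa_uniform_interpolation.
exact: iSLbox_uniform_interpolation.
Qed.
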